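(* Let $n\ge1$. The virtual symplectic cactus group $\widetilde J_{2n}$ is isomorphic to the symplectic cactus group $J_{\mathfrak{sp}(2n,\mathbb C)}$.
   Context: Intervals $[p,q]=\{p,\dots,q\}$, $p\le q$, are viewed as connected sub-diagrams of a Dynkin diagram. A union $J\sqcup J'$ of two sub-diagrams is disconnected if no node of $J$ equals or is adjacent to a node of $J'$. The symplectic cactus group $J_{\mathfrak{sp}(2n,\mathbb C)}$ is the group with generators $s_{[p,q]}$, $[p,q]\subseteq[n]$, and relations: (1C) $s_J^2=1$; (2C) $s_Js_{J'}=s_{J'}s_J$ if $J\sqcup J'$ is disconnected in $[n]$; (3C) (i) $s_{[p,n]}s_{[k,l]}=s_{[k,l]}s_{[p,n]}$ for $[k,l]\subseteq[p,n]\subseteq[n]$, and (ii) $s_{[p,q]}s_{[k,l]}=s_{[p+q-l,p+q-k]}s_{[p,q]}$ for $[k,l]\subseteq[p,q]\subseteq[n-1]$. The virtual symplectic cactus group $\widetilde J_{2n}$ is the group with generators $\tilde s_J$, where $J$ runs over the sub-diagrams of $[2n-1]$ (the $A_{2n-1}$ Dynkin diagram) of the form $J=[p,2n-p]$ with $1\le p\le n$, or $J=[p,q]\sqcup[2n-q,2n-p]$ with $[p,q]\subseteq[n-1]$, subject to the relations: (1) $\tilde s_J^2=1$; (2) $\tilde s_J\tilde s_{J'}=\tilde s_{J'}\tilde s_J$ whenever $J\sqcup J'$ is disconnected (no node of $J$ equal or adjacent to a node of $J'$); (3)(i) $\tilde s_{[p,2n-p]}$ commutes with $\tilde s_{[q,l]\sqcup[2n-l,2n-q]}$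 for $[q,l]\subseteq[p,n]\subseteq[n]$ (where for $l=n$ the index $[q,n]\sqcup[n,2n-q]$ means $[q,2n-q]$); (3)(ii) $\tilde s_{[p,q]\sqcup[2n-q,2n-p]}\,\tilde s_{[k,l]\sqcup[2n-l,2n-k]}=\tilde s_{[p+q-l,p+q-k]\sqcup[2n-(p+q)+k,\,2n-(p+q)+l]}\,\tilde s_{[p,q]\sqcup[2n-q,2n-p]}$ for $[k,l]\subseteq[p,q]\subseteq[n-1]$. *)

(* Defs.v *)
From HB Require Import structures.
From mathcomp Require Import all_boot boolp.
Set Implicit Arguments.
Unset Strict Implicit.
Unset Printing Implicit Defensive.

Local Open Scope quotient_scope.

(* Group words over X: (x, false) is the letter x and (x, true) the letter
   x^-1. *)
Definition gword (X : Type) : Type := seq (X * bool).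

Definition gword_inv (X : Type) (w : gword X) : gword X :=
  rev [seq (l.1, ~~ l.2) | l <- w].

Definition gword_pos (X : Type) (s : seq X) : gword X :=
  [seq (x, false) | x <- s].

(* R u v is the relation u = v; this is the smallest congruence on words that
   contains R and the free cancellations x x^-1 = x^-1 x = 1. *)
Inductive pres_eq (X : Type) (R : gword X -> gword X -> Prop) :
    gword X -> gword X -> Prop :=
| pres_eq_rel u v : R u v -> pres_eq R u v
| pres_eq_cancel x b : pres_eq R [:: (x, b); (x, ~~ b)] [::]
| pres_eq_refl u : pres_eq R u u
| pres_eq_sym u v : pres_eq R u v -> pres_eq R v u
| pres_eq_trans u v w : pres_eq R u v -> pres_eq R v w -> pres_eq R u w
| pres_eq_cat u u' v v' :
    pres_eq R u u' -> pres_eq R v v' -> pres_eq R (u ++ v) (u' ++ v').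

Definition pres_eqb (X : choiceType) (R : gword X -> gword X -> Prop) :
  rel (gword X) := fun u v => `[< pres_eq R u v >].

Lemma pres_eqb_equiv (X : choiceType) (R : gword X -> gword X -> Prop) :
  equiv_class_of (pres_eqb R).
Proof.
split=> [u|u v|v u w].
- exact/asboolP/pres_eq_refl.
- by apply/asboolP/asboolP => /pres_eq_sym.
- by move=> /asboolP uv /asboolP vw; apply/asboolP/(pres_eq_trans uv vw).
Qed.

Canonical pres_equiv_rel (X : choiceType) (R : gword X -> gword X -> Prop) :
  equiv_rel (gword X) := EquivRelPack (pres_eqb_equiv R).

(* The group < X | R >. *)
Definition presented (X : choiceType) (R : gword X -> gword X -> Prop) : Type :=
  {eq_quot (pres_equiv_rel R)}.

HB.instance Definition _ (X : choiceType) (R : gword X -> gword X -> Prop) :=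
  Choice.on (presented R).

Definition pres_class (X : choiceType) (R : gword X -> gword X -> Prop)
  (w : gword X) : presented R := \pi_({eq_quot (pres_equiv_rel R)}) w.

Definition pres_one (X : choiceType) (R : gword X -> gword X -> Prop) :
  presented R := pres_class R [::].

Definition pres_mul (X : choiceType) (R : gword X -> gword X -> Prop)
  (a b : presented R) : presented R := pres_class R (repr a ++ repr b).

Definition pres_inv (X : choiceType) (R : gword X -> gword X -> Prop)
  (a : presented R) : presented R := pres_class R (gword_inv (repr a)).

Section PresentedGroup.
Context (X : choiceType) (R : gword X -> gword X -> Prop).
Implicit Types (u v w : gword X) (a b c : presented R).

Lemma pres_classP u v : pres_class R u = pres_class R v <-> pres_eq R u v.
Proof.
split=> [/eqmodP/asboolP //|uv].
by apply/eqmodP/asboolP.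
Qed.

Lemma pres_classK a : pres_class R (repr a) = a.
Proof. exact: reprK. Qed.

Lemma pres_mulE u v :
  pres_mul (pres_class R u) (pres_class R v) = pres_class R (u ++ v).
Proof. by apply/pres_classP/pres_eq_cat; apply/pres_classP; rewrite pres_classK. Qed.

Lemma gword_inv_cat u v : gword_inv (u ++ v) = gword_inv v ++ gword_inv u.
Proof. by rewrite /gword_inv map_cat rev_cat. Qed.

Lemma gword_invK : involutive (@gword_inv X).
Proof.
move=> u; rewrite /gword_inv map_rev revK -map_comp -[RHS]map_id.
by apply: eq_map => -[x b] /=; rewrite negbK.
Qed.

Lemma pres_eq_invr u : pres_eq R (u ++ gword_inv u) [::].
Proof.
elim: u => [|[x b] u IH]; first exact: pres_eq_refl.
rewrite -cat1s gword_inv_cat -catA [u ++ _]catA.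
apply: (pres_eq_trans _ (pres_eq_cancel R x b)).
apply: (pres_eq_cat (pres_eq_refl R [:: (x, b)])).
exact: pres_eq_cat IH (pres_eq_refl R _).
Qed.

Lemma pres_eq_invl u : pres_eq R (gword_inv u ++ u) [::].
Proof. by have := pres_eq_invr (gword_inv u); rewrite gword_invK. Qed.

Lemma pres_mulA : associative (@pres_mul X R).
Proof.
by move=> a b c; rewrite -[a]pres_classK -[b]pres_classK -[c]pres_classK
  !pres_mulE catA.
Qed.

Lemma pres_mul1g : left_id (pres_one R) (@pres_mul X R).
Proof. by move=> a; rewrite -[a]pres_classK pres_mulE. Qed.

Lemma pres_mulg1 : right_id (pres_one R) (@pres_mul X R).
Proof. by move=> a; rewrite -[a]pres_classK pres_mulE cats0. Qed.

Lemma pres_mulVg : left_inverse (pres_one R) (@pres_inv X R) (@pres_mul X R).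
Proof.
move=> a; rewrite -[X in pres_mul _ X]pres_classK pres_mulE.
exact/pres_classP/pres_eq_invl.
Qed.

Lemma pres_mulgV : right_inverse (pres_one R) (@pres_inv X R) (@pres_mul X R).
Proof.
move=> a; rewrite -[X in pres_mul X _]pres_classK pres_mulE.
exact/pres_classP/pres_eq_invr.
Qed.

End PresentedGroup.

HB.instance Definition _ (X : choiceType) (R : gword X -> gword X -> Prop) :=
  isGroup.Build (presented R) (@pres_mulA X R) (@pres_mul1g X R)
    (@pres_mulg1 X R) (@pres_mulVg X R) (@pres_mulgV X R).

Definition isomorphic (G H : groupType) : Prop :=
  exists f : {multiplicative G -> H}, bijective f.

(* The nodes 1, ..., m of a linear Dynkin diagram are the nonzero elements of
   'I_m.+1; a sub-diagram is the set of its nodes, and never contains 0. *)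
Definition node (m : nat) : finType := 'I_m.+1.

Definition segment (m p q : nat) : {set node m} := [set i : node m | p <= i <= q].

Definition adjacent (m : nat) (i j : node m) : bool :=
  (i.+1 == j :> nat) || (j.+1 == i :> nat).

(* J and K may themselves be disconnected. *)
Definition disconnected (m : nat) (J K : {set node m}) : bool :=
  [forall i in J, forall j in K, (i != j) && ~~ adjacent i j].

Definition sp_index (n : nat) : choiceType :=
  {J : {set node n} |
    `[< exists p q : nat, 1 <= p <= q /\ q <= n /\ J = segment n p q >]}.

Inductive sp_rel (n : nat) : gword (sp_index n) -> gword (sp_index n) -> Prop :=
| sp_rel1 (J : sp_index n) : sp_rel (gword_pos [:: J; J]) [::]
| sp_rel2 (J K : sp_index n) : disconnected (val J) (val K) ->
    sp_rel (gword_pos [:: J; K]) (gword_pos [:: K; J])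
| sp_rel3i (p k l : nat) (J K : sp_index n) :
    1 <= p <= k -> k <= l <= n ->
    val J = segment n p n -> val K = segment n k l ->
    sp_rel (gword_pos [:: J; K]) (gword_pos [:: K; J])
| sp_rel3ii (p q k l : nat) (J K K' : sp_index n) :
    1 <= p <= k -> k <= l <= q -> q <= n.-1 ->
    val J = segment n p q -> val K = segment n k l ->
    val K' = segment n (p + q - l) (p + q - k) ->
    sp_rel (gword_pos [:: J; K]) (gword_pos [:: K'; J]).

Definition sp_cactus (n : nat) : groupType := presented (@sp_rel n).

(* [p, q] together with its mirror image [2n-q, 2n-p]; for q = n the two halves
   share the node n and the union is [p, 2n-p]. *)
Definition mirrored (n p q : nat) : {set node (2 * n).-1} :=
  segment _ p q :|: segment _ (2 * n - q) (2 * n - p).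

Definition virtual_index (n : nat) : choiceType :=
  {J : {set node (2 * n).-1} |
    `[< (exists p : nat, 1 <= p <= n /\ J = segment _ p (2 * n - p)) \/
        (exists p q : nat, 1 <= p <= q /\ q <= n.-1 /\ J = mirrored n p q) >]}.

Inductive virtual_rel (n : nat) :
    gword (virtual_index n) -> gword (virtual_index n) -> Prop :=
| virtual_rel1 (J : virtual_index n) : virtual_rel (gword_pos [:: J; J]) [::]
| virtual_rel2 (J K : virtual_index n) : disconnected (val J) (val K) ->
    virtual_rel (gword_pos [:: J; K]) (gword_pos [:: K; J])
| virtual_rel3i (p q l : nat) (J K : virtual_index n) :
    1 <= p <= q -> q <= l <= n ->
    val J = segment _ p (2 * n - p) -> val K = mirrored n q l ->
    virtual_rel (gword_pos [:: J; K]) (gword_pos [:: K; J])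
| virtual_rel3ii (p q k l : nat) (J K K' : virtual_index n) :
    1 <= p <= k -> k <= l <= q -> q <= n.-1 ->
    val J = mirrored n p q -> val K = mirrored n k l ->
    val K' = segment _ (p + q - l) (p + q - k)
               :|: segment _ (2 * n - (p + q) + k) (2 * n - (p + q) + l) ->
    virtual_rel (gword_pos [:: J; K]) (gword_pos [:: K'; J]).

Definition virtual_cactus (n : nat) : groupType := presented (@virtual_rel n).

(* Main.v *)
Require Import Defs.
From mathcomp Require Import all_boot.
From HB Require Import structures.
From mathcomp Require Import boolp zify.

Set Implicit Arguments.
Unset Strict Implicit.
Unset Printing Implicit Defensive.

(** The folding i |-> min (i, 2n - i) of the diagram A_(2n-1) onto the nodes
    1, ..., n identifies each node with its mirror image. The preimage
    of [p, q] under it is [p, q] together with its mirror image, so taking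
    preimages is a bijection between the two sets of generators
    ([unfold_segment]); the inverse intersects a symmetric sub-diagram with
    [1, n] ([half_mirrored]).

    Both the folding and the inclusion of [1, n] into [1, 2n-1] send adjacent
    nodes to adjacent nodes, and disconnectedness pulls back along such a map
    ([disconnected_preimset]). Hence the bijection matches the commutations of
    disconnected generators. It matches the involution relations trivially, and
    the remaining relations because those are indexed by segments on one side
    and by the preimages of the same segments on the other. Groups whose
    presentations match along a bijection of the generators are isomorphic
    ([isomorphic_presented]). *)

(** * Renaming the generators of a presentation *)

Definition gword_map (X Y : Type) (f : X -> Y) (w : gword X) : gword Y :=
  [seq (f l.1, l.2) | l <- w].

Lemma gword_map_cat (X Y : Type) (f : X -> Y) (u v : gword X) :
  gword_map f (u ++ v) = gword_map f u ++ gword_map f v.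
Proof. exact: map_cat. Qed.

Lemma gword_mapK (X Y : Type) (f : X -> Y) (g : Y -> X) :
  cancel f g -> cancel (gword_map f) (gword_map g).
Proof.
move=> fK w; rewrite /gword_map -map_comp -[RHS]map_id.
by apply: eq_map => -[x b] /=; rewrite fK.
Qed.

Lemma pres_eq_map (X Y : Type) (f : X -> Y)
    (R : gword X -> gword X -> Prop) (S : gword Y -> gword Y -> Prop) :
  (forall u v, R u v -> S (gword_map f u) (gword_map f v)) ->
  forall u v, pres_eq R u v -> pres_eq S (gword_map f u) (gword_map f v).
Proof.
move=> RS u v; elim=> {u v} [u v /RS|x b|u|u v _ IH|u v w _ IHu _ IHv|
    u u' v v' _ IHu _ IHv].
- exact: pres_eq_rel.
- exact: pres_eq_cancel.
- exact: pres_eq_refl.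
- exact: pres_eq_sym.
- exact: pres_eq_trans IHu IHv.
- by rewrite !gword_map_cat; apply: pres_eq_cat.
Qed.

Definition pres_map (X Y : choiceType) (f : X -> Y)
    (R : gword X -> gword X -> Prop) (S : gword Y -> gword Y -> Prop)
    (a : presented R) : presented S :=
  pres_class S (gword_map f (repr a)).

Lemma pres_map_class (X Y : choiceType) (f : X -> Y)
    (R : gword X -> gword X -> Prop) (S : gword Y -> gword Y -> Prop) :
  (forall u v, R u v -> S (gword_map f u) (gword_map f v)) ->
  forall w, pres_map f S (pres_class R w) = pres_class S (gword_map f w).
Proof.
move=> RS w; apply/pres_classP; apply: pres_eq_map RS _ _ _.
by apply/pres_classP; rewrite pres_classK.
Qed.

Lemma pres_mapK (X Y : choiceType) (f : X -> Y) (g : Y -> X)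
    (R : gword X -> gword X -> Prop) (S : gword Y -> gword Y -> Prop) :
  (forall u v, S u v -> R (gword_map g u) (gword_map g v)) ->
  cancel f g -> cancel (@pres_map _ _ f R S) (@pres_map _ _ g S R).
Proof.
move=> SR fK a.
by rewrite [pres_map f _ _]/pres_map pres_map_class// gword_mapK// pres_classK.
Qed.

Lemma isomorphic_presented (X Y : choiceType) (f : X -> Y) (g : Y -> X)
    (R : gword X -> gword X -> Prop) (S : gword Y -> gword Y -> Prop) :
  cancel f g -> cancel g f ->
  (forall u v, R u v -> S (gword_map f u) (gword_map f v)) ->
  (forall u v, S u v -> R (gword_map g u) (gword_map g v)) ->
  isomorphic (presented R) (presented S).
Proof.
move=> fK gK RS SR.
have fM : {morph @pres_map _ _ f R S : a b / (a * b)%g}.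
  move=> a b; change (pres_map f S (pres_mul a b) =
    pres_mul (pres_map f S a) (pres_map f S b)).
  by rewrite /pres_mul pres_map_class// gword_map_cat -pres_mulE.
pose mM := isMultiplicative.Build _ _ (@pres_map _ _ f R S) fM.
pose F : {multiplicative presented R -> presented S} :=
  HB.pack (@pres_map _ _ f R S) mM.
by exists F; exists (@pres_map _ _ g S R); apply: pres_mapK.
Qed.

(** * Folding the diagram *)

(** The minimum is at most n, so the default value of [inord] never occurs. The
    node 0, which lies outside the diagram, is sent to 0. *)
Definition fold_node (n : nat) (i : node (2 * n).-1) : node n :=
  inord (minn i (2 * n - i)).

Definition include_node (n : nat) (i : node n) : node (2 * n).-1 := inord i.

Lemma fold_nodeE (n : nat) (i : node (2 * n).-1) :
  fold_node i = minn i (2 * n - i) :> nat.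
Proof. by rewrite inordK //; lia. Qed.

Lemma include_nodeE (n : nat) (i : node n) :
  1 <= n -> include_node i = i :> nat.
Proof. by move=> hn; rewrite inordK //; have := ltn_ord i; lia. Qed.

Lemma include_nodeK (n : nat) :
  1 <= n -> cancel (@include_node n) (@fold_node n).
Proof.
move=> hn i; apply: val_inj => /=; have := ltn_ord i.
rewrite fold_nodeE include_nodeE //; lia.
Qed.

(** The middle of the diagram is a node, not an edge: no edge joins a node to
    its mirror image, so folding never collapses an edge. *)
Lemma fold_node_adjacent (n : nat) (i j : node (2 * n).-1) :
  adjacent i j -> adjacent (fold_node i) (fold_node j).
Proof.
rewrite /adjacent !fold_nodeE; have := ltn_ord i; have := ltn_ord j; lia.
Qed.

Lemma include_node_adjacent (n : nat) (i j : node n) :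
  1 <= n -> adjacent i j -> adjacent (include_node i) (include_node j).
Proof. by move=> hn; rewrite /adjacent !include_nodeE. Qed.

(** Contrapositive: equal nodes have equal images, adjacent nodes have adjacent
    images. *)
Lemma disconnected_preimset (m m' : nat) (f : node m -> node m')
    (J K : {set node m'}) :
  {homo f : i j / adjacent i j} ->
  disconnected J K -> disconnected (f @^-1: J) (f @^-1: K).
Proof.
move=> fA JK; apply/forall_inP => i; rewrite inE => iJ.
apply/forall_inP => j; rewrite inE => jK.
have /forall_inP/(_ _ jK)/andP[ij nA] := forall_inP JK _ iJ.
by rewrite (contraNneq _ ij) ?(contraNN (@fA i j) nA) // => ->.
Qed.

Definition unfold (n : nat) (J : {set node n}) : {set node (2 * n).-1} :=
  @fold_node n @^-1: J.

Definition half (n : nat) (J : {set node (2 * n).-1}) : {set node n} :=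
  @include_node n @^-1: J.

Lemma unfoldK (n : nat) : 1 <= n -> cancel (@unfold n) (@half n).
Proof. by move=> hn J; apply/setP => i; rewrite !inE include_nodeK. Qed.

Lemma unfold_segment (n p q : nat) :
  p <= q <= n -> unfold (segment n p q) = mirrored n p q.
Proof.
move=> qn; apply/setP => i; rewrite !inE fold_nodeE; have := ltn_ord i; lia.
Qed.

Lemma half_mirrored (n p q : nat) :
  1 <= n -> p <= q <= n -> half (mirrored n p q) = segment n p q.
Proof. by move=> hn qn; rewrite -unfold_segment // unfoldK. Qed.

Lemma mirrored_middle (n p : nat) :
  p <= n -> mirrored n p n = segment _ p (2 * n - p).
Proof. by move=> pn; apply/setP => i; rewrite !inE; lia. Qed.

Lemma mirrored_reflect (n p q k l : nat) :
  1 <= p <= k -> k <= l <= q -> q <= n.-1 ->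
  mirrored n (p + q - l) (p + q - k) =
    segment _ (p + q - l) (p + q - k)
      :|: segment _ (2 * n - (p + q) + k) (2 * n - (p + q) + l).
Proof. by move=> pk klq qn; apply/setP => i; rewrite !inE; lia. Qed.

(** * Matching the two presentations *)

Lemma sp_indexP (n : nat) (J : sp_index n) :
  exists p q, [/\ 1 <= p <= q, q <= n & val J = segment n p q].
Proof.
by case: J => J HJ /=; have /asboolP[p [q [? [? ?]]]] := HJ; exists p, q.
Qed.

(** The two halves of a mirrored segment ending at n share that node, so both
    families of generators of the virtual group have the same form. *)
Lemma virtual_indexP (n : nat) (J : {set node (2 * n).-1}) :
  (exists p : nat, 1 <= p <= n /\ J = segment _ p (2 * n - p)) \/
    (exists p q : nat, 1 <= p <= q /\ q <= n.-1 /\ J = mirrored n p q) <->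
  exists p q, [/\ 1 <= p <= q, q <= n & J = mirrored n p q].
Proof.
split=> [[[p [pn ->]]|[p [q [pq [qn ->]]]]]|[p [q [pq qn ->]]]].
- by exists p, n; split=> //; rewrite mirrored_middle //; lia.
- by exists p, q; split=> //; lia.
- have [qn'|qn'] := eqVneq q n; [left|right].
  + exists p; rewrite qn' mirrored_middle; last by lia.
    by split=> //; lia.
  + by exists p, q; split=> //; split=> //; lia.
Qed.

Lemma unfold_index_subproof (n : nat) (J : sp_index n) :
  `[< (exists p : nat, 1 <= p <= n /\
         unfold (val J) = segment _ p (2 * n - p)) \/
      (exists p q : nat, 1 <= p <= q /\ q <= n.-1 /\
         unfold (val J) = mirrored n p q) >].
Proof.
apply/asboolP/virtual_indexP; have [p [q [pq qn ->]]] := sp_indexP J.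
by exists p, q; rewrite unfold_segment //; lia.
Qed.

Definition unfold_index (n : nat) (J : sp_index n) : virtual_index n :=
  exist _ (unfold (val J)) (unfold_index_subproof J).

Lemma half_index_subproof (n : nat) (hn : 1 <= n) (J : virtual_index n) :
  `[< exists p q : nat,
        1 <= p <= q /\ q <= n /\ half (val J) = segment n p q >].
Proof.
case: J => J HJ /=; have /asboolP/virtual_indexP[p [q [pq qn ->]]] := HJ.
by apply/asboolP; exists p, q; rewrite half_mirrored //; lia.
Qed.

Definition half_index (n : nat) (hn : 1 <= n) (J : virtual_index n) :
    sp_index n :=
  exist _ (half (val J)) (half_index_subproof hn J).

Lemma unfold_indexK (n : nat) (hn : 1 <= n) :
  cancel (@unfold_index n) (half_index hn).
Proof. by move=> J; apply: val_inj; apply: unfoldK. Qed.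

Lemma half_indexK (n : nat) (hn : 1 <= n) :
  cancel (half_index hn) (@unfold_index n).
Proof.
move=> [J HJ]; apply: val_inj => /=.
have /asboolP/virtual_indexP[p [q [pq qn ->]]] := HJ.
by rewrite half_mirrored ?unfold_segment //; lia.
Qed.

Lemma half_rel (n : nat) (hn : 1 <= n) (u v : gword (virtual_index n)) :
  virtual_rel u v ->
  sp_rel (gword_map (half_index hn) u) (gword_map (half_index hn) v).
Proof.
case=> [J|J K JK|p q l J K pq qln eJ eK|p q k l J K K' pk klq qn eJ eK eK'].
- exact: sp_rel1.
- apply: sp_rel2; apply: disconnected_preimset JK => i j.
  exact: include_node_adjacent.
- apply: (@sp_rel3i _ p q l) => //=.
  + by rewrite eJ -mirrored_middle ?half_mirrored //; lia.
  + by rewrite eK half_mirrored //; lia.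
- apply: (@sp_rel3ii _ p q k l) => //=.
  + by rewrite eJ half_mirrored //; lia.
  + by rewrite eK half_mirrored //; lia.
  + by rewrite eK' -mirrored_reflect ?half_mirrored //; lia.
Qed.

Lemma unfold_rel (n : nat) (u v : gword (sp_index n)) :
  sp_rel u v ->
  virtual_rel (gword_map (@unfold_index n) u) (gword_map (@unfold_index n) v).
Proof.
case=> [J|J K JK|p k l J K pk kln eJ eK|p q k l J K K' pk klq qn eJ eK eK'].
- exact: virtual_rel1.
- apply: virtual_rel2; apply: disconnected_preimset JK => i j.
  exact: fold_node_adjacent.
- apply: (@virtual_rel3i _ p k l) => //=.
  + by rewrite eJ unfold_segment ?mirrored_middle //; lia.
  + by rewrite eK unfold_segment //; lia.
- apply: (@virtual_rel3ii _ p q k l) => //=.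
  + by rewrite eJ unfold_segment //; lia.
  + by rewrite eK unfold_segment //; lia.
  + by rewrite eK' -mirrored_reflect ?unfold_segment //; lia.
Qed.

Theorem proposition4 (n : nat) (hn : 1 <= n) :
  isomorphic (virtual_cactus n) (sp_cactus n).
Proof.
exact: isomorphic_presented (half_indexK hn) (unfold_indexK hn)
  (@half_rel n hn) (@unfold_rel n).
Qed.
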